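(* Let $\{\mu_n\}_{n\in\mathbb{N}^*}$ be a sequence of positive real numbers and let $\mathcal{E}_\infty$ be the $\infty$-ellipsoid with semi-axes $\{\mu_n\}_{n\in\mathbb{N}^*}$. Then, for all $\varepsilon>0$, we have $$H\left(\varepsilon;\mathcal{E}_\infty,\|\cdot\|_\infty\right)=\sum_{k=1}^\infty\log\left(1+\frac1k\right)M_k(\varepsilon),$$ with the counting function $$M_k\colon t\in\mathbb{R}^*_+\longmapsto\#\left\{n\in\mathbb{N}^*\mid\mu_n>k\,t\right\},\qquad\text{for }k\in\mathbb{N}^*.$$
   Context: $\mathbb{N}^*=\{1,2,\dots\}$, $\mathbb{R}^*_+=(0,\infty)$, $\#$ denotes cardinality, and $\log$ is the logarithm to base 2. The semi-axes are not required to be non-increasing or to tend to zero. $\mathcal{E}_\infty=\{x\in\ell^\infty(\mathbb{N}^*;\mathbb{R}):\sup_n|x_n/\mu_n|\le1\}$. The covering number $N(\varepsilon;\mathcal{E}_\infty,\|\cdot\|_\infty)$ is the smallest cardinality of a finite set of points of $\ell^\infty$ such that each $x\in\mathcal{E}_\infty$ is within $\ell^\infty$-distance at most $\varepsilon$ of one of them ($\infty$ if there is no such finite set), and $H(\varepsilon;\mathcal{E}_\infty,\|\cdot\|_\infty)=\log N(\varepsilon;\mathcal{E}_\infty,\|\cdot\|_\infty)$. Both sides of the identity, and the values $M_k(\varepsilon)$, take values in $[0,\infty]$. *)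

(* Defs.v *)
From mathcomp Require Import all_boot all_order all_algebra.
From mathcomp Require Import all_classical all_reals all_analysis.

Set Implicit Arguments.
Unset Strict Implicit.
Unset Printing Implicit Defensive.

Import Order.TTheory GRing.Theory Num.Theory.

Local Open Scope classical_set_scope.
Local Open Scope ring_scope.

(* Sequences indexed by {1, 2, ...} are represented by functions on nat, the
   value at n standing for the term of index n + 1. *)

Definition sup_norm (R : realType) (x : nat -> R) : \bar R :=
  ereal_sup (range (fun n => (`|x n|)%:E)).

Definition ell_infty (R : realType) : set (nat -> R) :=
  [set x | (sup_norm x < +oo)%E].

Definition ellipsoid_infty (R : realType) (mu : nat -> R) : set (nat -> R) :=
  [set x | ell_infty x /\ (sup_norm (fun n => (x n / mu n)%R) <= 1)%E].

Definition covers (R : realType) (eps : R) (A C : set (nat -> R)) : Prop :=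
  forall x, A x -> exists2 c, C c & (sup_norm (fun n => (x n - c n)%R) <= eps%:E)%E.

(* The infimum ranges over a set of natural numbers: it is a minimum when a
   finite cover exists, and is +oo otherwise. *)
Definition covering_number (R : realType) (eps : R) (A : set (nat -> R)) :
    \bar R :=
  ereal_inf [set counting C | C in
    [set C : set (nat -> R) |
      [/\ finite_set C, C `<=` @ell_infty R & covers eps A C]]].

Definition log2 (R : realType) (x : R) : R := ln x / ln 2.

Definition log2e (R : realType) (x : \bar R) : \bar R :=
  (lne x * ((ln 2 : R)^-1)%:E)%E.

Definition metric_entropy (R : realType) (eps : R) (A : set (nat -> R)) :
    \bar R :=
  log2e (covering_number eps A).

Definition counting_fun (R : realType) (mu : nat -> R) (k : nat) (t : R) :
    \bar R :=
  counting [set n : nat | k%:R * t < mu n].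

(* Main.v *)
(* The ellipsoid is the box of the sequences with |x_n| <= mu_n, so everything
   happens coordinatewise. Let K_n be the number of k >= 1 with
   k * eps < mu_n. The interval [- mu_n, mu_n] contains K_n + 1 points at
   distances larger than 2 eps and is the union of K_n + 1 intervals of length
   at most 2 eps. Hence the covering number is at least the product of the
   K_n + 1 over any finite set of indices, and equals the full product when
   K_n = 0 for all large n. As log2 (K + 1) telescopes into the sum of
   log2 (1 + 1/k) over k <= K, exchanging the sums over n and k turns the
   right-hand side into the sum of the log2 (K_n + 1). When K_n > 0 for
   infinitely many n both sides are infinite. *)

Require Import Defs.
From mathcomp Require Import all_boot all_order all_algebra.
From mathcomp Require Import all_classical all_reals all_analysis.
From mathcomp Require Import finmap ring lra.

Set Implicit Arguments.
Unset Strict Implicit.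
Unset Printing Implicit Defensive.

Import Order.TTheory GRing.Theory Num.Theory.

Local Open Scope classical_set_scope.
Local Open Scope ring_scope.

(** * Sup norm and the ellipsoid as a box *)

Lemma sup_norm_leP (R : realType) (x : nat -> R) (c : R) :
  (sup_norm x <= c%:E)%E <-> (forall n, `|x n| <= c).
Proof.
split=> [/ereal_supP h n|h]; first by rewrite -lee_fin; apply: h; exists n.
by apply/ereal_supP => _ [n _ <-]; rewrite lee_fin.
Qed.

Lemma finite_support_ell_infty (R : realType) (J : nat) (x : nat -> R) :
  (forall n, (J <= n)%N -> x n = 0) -> ell_infty x.
Proof.
move=> x0; apply: (@le_lt_trans _ _ (\sum_(i < J) `|x i|)%:E); last exact: ltry.
apply/sup_norm_leP => n; have [nJ|/x0->] := ltnP n J.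
  by rewrite (bigD1 (Ordinal nJ)) //= lerDl sumr_ge0.
by rewrite normr0 sumr_ge0.
Qed.

Lemma ellipsoid_inftyP (R : realType) (mu : nat -> R) (x : nat -> R) :
  (forall n, 0 < mu n) ->
  ellipsoid_infty mu x <-> ell_infty x /\ (forall n, `|x n| <= mu n).
Proof.
move=> mu0; rewrite /ellipsoid_infty /=.
suff -> : (sup_norm (fun n => (x n / mu n)%R) <= 1)%E <->
          forall n, `|x n| <= mu n by [].
split=> [/sup_norm_leP h n|h]; last apply/sup_norm_leP => n.
  by have := h n; rewrite normrM normfV (gtr0_norm (mu0 n)) ler_pdivrMr ?mul1r.
by rewrite normrM normfV (gtr0_norm (mu0 n)) ler_pdivrMr ?mul1r.
Qed.

(** * Nets and packings of one interval *)

Lemma multiples_lt (R : realType) (x eps : R) : 0 < x -> 0 < eps ->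
  exists K : nat, forall k : nat, (k%:R * eps < x) = (k <= K)%N.
Proof.
(* [K] is the least [m] with [x <= m.+1%:R * eps]. Since [0 < x], the left-hand side holds at
   [k = 0], in agreement with [0 <= K]. *)
move=> x0 e0; have [|m xm mmin] := @ex_minnP (fun m => x <= m.+1%:R * eps).
  exists (Num.truncn (x / eps)).
  by rewrite -ler_pdivrMr // ltW // truncnS_gt.
exists m => k; have [km|mk] := leqP k m.
  case: k km => [|k] km; first by rewrite mul0r.
  by rewrite ltNge; apply/negP => /mmin; rewrite leqNgt km.
apply/negbTE; rewrite -leNgt (le_trans xm) // ler_pM2r // ler_nat //.
Qed.

(** Cut the interval from [- m] to [m] into [K.+1] equal pieces of half-length [r = m / K.+1%:R],
    which is at most [e]; the net consists of their midpoints. *)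
Lemma interval_net (R : realType) (m e : R) (K : nat) :
  0 < m -> m <= K.+1%:R * e ->
  exists c : 'I_K.+1 -> R, forall x, `|x| <= m -> exists i, `|x - c i| <= e.
Proof.
move=> m0 me; set r := m / K.+1%:R.
have K0 : 0 < K.+1%:R :> R by [].
have r0 : 0 < r by rewrite divr_gt0.
have re : r <= e by rewrite ler_pdivrMr // mulrC.
have Er : m = K.+1%:R * r by rewrite mulrC divfK // gt_eqF.
exists (fun i => (2 * i%:R + 1) * r - m) => x /[!ler_norml] /andP[xl xr].
have t0 : 0 <= (x + m) / (2 * r) by rewrite divr_ge0; lra.
have /andP[] := truncn_itv t0; set g := Num.truncn _.
rewrite ler_pdivlMr ?ltr_pdivrMr; [|lra|lra] => gl gr.
have [gK|gK] := leqP g K.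
  exists (Ordinal (gK : (g < K.+1)%N)); rewrite /= ler_norml.
  by rewrite -natr1 in gr; apply/andP; split; nra.
(* The piece number [g] exceeds [K] only at the right endpoint, which is assigned to the last
   piece. *)
have xm : x = m.
  apply/eqP; rewrite eq_le xr /=.
  have : K.+1%:R <= g%:R :> R by rewrite ler_nat.
  nra.
exists ord_max; rewrite /= xm ler_norml; move: Er; rewrite -natr1 => Er.
by apply/andP; split; nra.
Qed.

(** For [K > 0], equally spaced points including both endpoints have gap [2 * m / K%:R], which
    exceeds [2 * e] because [K%:R * e < m]. *)
Lemma interval_packing (R : realType) (m e : R) (K : nat) :
  0 < m -> K%:R * e < m ->
  exists p : 'I_K.+1 -> R, (forall i, `|p i| <= m) /\
    (forall i j, i != j -> 2 * e < `|p i - p j|).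
Proof.
move=> m0 em; exists (fun i => 2 * m * (i%:R / K%:R) - m); split=> [i|].
  have [K0|K0] := eqVneq K 0%N.
    (* The single point is then - m, because 0 / 0 = 0. *)
    have -> : K%:R = 0 :> R by rewrite K0.
    by rewrite invr0 !mulr0 sub0r normrN gtr0_norm.
  have : i%:R / K%:R <= 1 :> R.
    by rewrite ler_pdivrMr ?ltr0n ?lt0n // mul1r ler_nat -ltnS.
  have : 0 <= i%:R / K%:R :> R by rewrite divr_ge0.
  by move=> *; rewrite ler_norml; apply/andP; split; nra.
have sep (i j : 'I_K.+1) : (j < i)%N ->
    2 * e < 2 * m * (i%:R / K%:R) - m - (2 * m * (j%:R / K%:R) - m).
  move=> ji; have K0 : (0 < K)%N.
    by rewrite (leq_trans _ (leq_ord i)) // (leq_trans _ ji).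
  have -> : 2 * m * (i%:R / K%:R) - m - (2 * m * (j%:R / K%:R) - m) =
            2 * (m * (i%:R - j%:R)) / K%:R by ring.
  rewrite ltr_pdivlMr ?ltr0n //.
  have : 1 <= i%:R - j%:R :> R by rewrite lerBrDl natr1 ler_nat.
  nra.
move=> i j ij; have := ltngtP i j.
case=> [ltij|ltji|/val_inj/eqP]; last by rewrite (negbTE ij).
  by rewrite distrC (lt_le_trans (sep _ _ ltij)) ?ler_norm.
by rewrite (lt_le_trans (sep _ _ ltji)) ?ler_norm.
Qed.

Lemma card_dffun_ord (J : nat) (K : nat -> nat) :
  #|{dffun forall i : 'I_J, 'I_(K i).+1}| = (\prod_(i < J) (K i).+1)%N.
Proof.
rewrite card_dep_ffun foldrE big_map big_enum /=.
by apply: eq_bigr => i _; rewrite card_ord.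
Qed.

(** By the triangle inequality a ball of radius [eps] contains at most one [x t], so sending [t] to
    a centre close to [x t] is injective. *)
Lemma covering_packing_le (R : realType) (eps : R) (A C : set (nat -> R))
    (T : finType) (x : T -> nat -> R) :
  covers eps A C -> finite_set C -> (forall t, A (x t)) ->
  (forall s t, s != t -> exists n, 2 * eps < `|x s n - x t n|) ->
  (#|T| <= #|` fset_set C|)%N.
Proof.
move=> covC finC Ax sep.
have /choice[c cP] t : exists c : nat -> R,
    C c /\ forall n, `|x t n - c n| <= eps.
  by have [c Cc /sup_norm_leP] := covC _ (Ax t); exists c.
have cC t : c t \in fset_set C by rewrite in_fset_set // mem_set; case: (cP t).
rewrite cardfE; apply: (@leq_card _ _ (fun t => [` cC t]%fset)) => s t.
move=> /(congr1 val) /= cst; apply/eqP; apply: contraT => /sep[n].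
rewrite ltNge (le_trans (ler_distD (c s n) _ _)) //.
have -> : 2 * eps = eps + eps by ring.
by rewrite lerD ?(proj2 (cP s) n) // cst distrC (proj2 (cP t) n).
Qed.

(** * Logarithms to base 2 *)

Lemma log2_ge0 (R : realType) (x : R) : 1 <= x -> 0 <= log2 x.
Proof. by move=> x1; rewrite divr_ge0 // ln_ge0 // ler1n. Qed.

Lemma log2M (R : realType) (x y : R) : 0 < x -> 0 < y -> log2 (x * y) = log2 x + log2 y.
Proof. by move=> x0 y0; rewrite /log2 lnM // mulrDl. Qed.

Lemma log2_prod (R : realType) (J : nat) (a : nat -> nat) :
  log2 (\prod_(i < J) (a i).+1)%:R = \sum_(0 <= i < J) log2 (a i).+1%:R :> R.
Proof.
rewrite big_mkord; elim: J => [|J IH].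
  by rewrite !big_ord0 /log2 ln1 mul0r.
rewrite !big_ord_recr /= natrM log2M ?IH ?ltr0n //.
by rewrite prodn_gt0.
Qed.

Lemma sum_log2_telescope (R : realType) (k : nat) :
  \sum_(1 <= i < k.+1) log2 (1 + i%:R^-1) = log2 k.+1%:R :> R.
Proof.
elim: k => [|k IH]; first by rewrite big_geq // /log2 ln1 mul0r.
rewrite big_nat_recr //= IH -log2M ?ltr0n ?addr_gt0 ?invr_gt0 //.
congr log2; have k0 : k.+1%:R != 0 :> R by rewrite pnatr_eq0.
by rewrite mulrDr mulr1 mulfV // natr1.
Qed.

Lemma log2e_EFin (R : realType) (x : R) : 0 < x -> log2e x%:E = (log2 x)%:E.
Proof. by move=> x0; rewrite /log2e lne_EFin. Qed.

Lemma le_log2e (R : realType) (x y : \bar R) :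
  (0 <= x)%E -> (x <= y)%E -> (log2e x <= log2e y)%E.
Proof.
move=> x0 xy; rewrite /log2e lee_wpmul2r //.
  by rewrite lee_fin invr_ge0 ln_ge0 // ler1n.
by rewrite lee_lne // in_itv /= leey ?x0 ?(le_trans x0 xy).
Qed.

(** * Covering numbers of the ellipsoid and the exchange of sums *)

Section Ellipsoid.
Variables (R : realType) (mu : nat -> R) (eps : R) (K : nat -> nat).
Hypothesis mu_gt0 : forall n, 0 < mu n.
Hypothesis KP : forall n k : nat, (k%:R * eps < mu n) = (k <= K n)%N.

(** Choosing a packing point in each of the first [J] coordinates and zero afterwards gives points
    of the ellipsoid; two of them are more than [2 * eps] apart in any coordinate where the choices
    differ. *)
Lemma ellipsoid_cover_ge (J : nat) (C : set (nat -> R)) :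
  covers eps (ellipsoid_infty mu) C -> finite_set C ->
  (\prod_(i < J) (K i).+1 <= #|` fset_set C|)%N.
Proof.
move=> covC finC; rewrite -card_dffun_ord.
have [p pP] := all_sig (fun n => cid (interval_packing (mu_gt0 n)
  (etrans (KP n (K n)) (leqnn _)))).
pose x (f : {dffun forall i : 'I_J, 'I_(K i).+1}) n :=
  if (insub n : option 'I_J) is Some i then p i (f i) else 0.
have xE f (i : 'I_J) : x f i = p i (f i) by rewrite /x valK.
have x0 f n : (J <= n)%N -> x f n = 0 by move=> Jn; rewrite /x insubN // -leqNgt.
apply: (covering_packing_le (x := x) covC finC) => [f|f g fg].
  apply/ellipsoid_inftyP => //; split.
    exact: (finite_support_ell_infty (x0 f)).
  move=> n; have [nJ|Jn] := ltnP n J; last by rewrite x0 // normr0 ltW.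
  by rewrite (xE f (Ordinal nJ)); have [] := pP n.
have [i fgi] : exists i, f i != g i.
  apply/existsP; apply: contraNT fg => /existsPn fg; apply/eqP/ffunP => i.
  by have := fg i; rewrite negbK => /eqP.
by exists i; rewrite !xE; have [_] := pP i; apply.
Qed.

(** The centres combine the nets of the first [J] coordinates and vanish afterwards. From [J] on,
    [K n = 0] means [mu n <= eps], so zero approximates every admissible coordinate. *)
Lemma ellipsoid_cover_exists (J : nat) : 0 < eps ->
  (forall n, (J <= n)%N -> K n = 0%N) ->
  exists C, [/\ finite_set C, C `<=` @ell_infty R,
    covers eps (ellipsoid_infty mu) C &
    (#|` fset_set C| <= \prod_(i < J) (K i).+1)%N].
Proof.
move=> eps0 K0; rewrite -card_dffun_ord.
have mu_le n : mu n <= (K n).+1%:R * eps by rewrite leNgt KP ltnn.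
have [c cP] := all_sig (fun n => cid (interval_net (mu_gt0 n) (mu_le n))).
pose z (f : {dffun forall i : 'I_J, 'I_(K i).+1}) n :=
  if (insub n : option 'I_J) is Some i then c i (f i) else 0.
have zE f (i : 'I_J) : z f i = c i (f i) by rewrite /z valK.
have z0 f n : (J <= n)%N -> z f n = 0 by move=> Jn; rewrite /z insubN // -leqNgt.
exists (range z); split.
- exact/finite_image/finite_finset.
- by move=> _ [f _ <-]; exact: (finite_support_ell_infty (z0 f)).
- move=> x /(ellipsoid_inftyP _ mu_gt0)[_ xmu].
  have [g gP] := all_sig (fun n => cid (cP n (x n) (xmu n))).
  exists (z [ffun i : 'I_J => g i]); first by exists [ffun i : 'I_J => g i].
  apply/sup_norm_leP => n; have [nJ|Jn] := ltnP n J.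
    by rewrite (zE _ (Ordinal nJ)) ffunE.
  by rewrite z0 // subr0 (le_trans (xmu n)) // (le_trans (mu_le n)) // K0 ?mul1r.
- rewrite fset_set_image; last exact: finite_finset.
  apply: leq_trans (leq_imfset_card _ _ _) _ => /=.
  by rewrite cardfE; exact: (leq_card val val_inj).
Qed.

Lemma covering_number_ge (J : nat) :
  ((\prod_(i < J) (K i).+1)%:R%:E <= covering_number eps (ellipsoid_infty mu))%E.
Proof.
apply/ereal_infP => _ [C [finC _ covC] <-].
rewrite /counting asboolT // lee_fin ler_nat.
exact: ellipsoid_cover_ge.
Qed.

Lemma covering_number_le (J : nat) : 0 < eps ->
  (forall n, (J <= n)%N -> K n = 0%N) ->
  (covering_number eps (ellipsoid_infty mu) <= (\prod_(i < J) (K i).+1)%:R%:E)%E.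
Proof.
move=> eps0 /(ellipsoid_cover_exists eps0)[C [finC bC covC CJ]].
apply/ge_ereal_inf; exists (counting C); first by exists C.
by rewrite /counting asboolT // lee_fin ler_nat.
Qed.

(** The counting measure is a sum over [n] of indicators of [k <= K n], and all terms are
    nonnegative, so the two series may be exchanged. *)
Lemma counting_sum_log2 :
  (\sum_(1 <= k <oo) (log2 (1 + k%:R^-1)%R)%:E * counting_fun mu k eps =
   \sum_(n <oo) (log2 ((K n).+1%:R : R))%:E)%E.
Proof.
pose a n k : \bar R := ((log2 (1 + k%:R^-1)) * (k <= K n)%:R)%:E.
have a0 n k : (0 <= a n k)%E.
  by rewrite lee_fin mulr_ge0 // log2_ge0 // lerDl invr_ge0.
transitivity (\sum_(k <oo | (1 <= k)%N) \sum_(n <oo) a n k)%E.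
  rewrite ereal_series; apply: eq_eseriesr => k _.
  rewrite /counting_fun counting_dirac -nneseriesZl //; apply: eq_eseriesr => n _.
  rewrite diracE /a EFinM -KP; congr (_ * (nat_of_bool _)%:R%:E)%E.
  by apply/idP/idP => [/set_mem //|kmu]; exact/mem_set.
rewrite nneseries_interchange; last by move=> *; exact: a0.
apply: eq_eseriesr => n _; rewrite -ereal_series.
(* For fixed [n] the terms with [k > K n] vanish, which leaves the telescoping finite sum. *)
rewrite (nneseries_split _ (K n)) // eseries0 ?adde0 => [|k Kk _]; last first.
  by rewrite /a leqNgt -add1n Kk mulr0.
rewrite add1n -sum_log2_telescope -sumEFin; apply: eq_big_nat => k /andP[_ kK].
by rewrite /a -ltnS kK mulr1.
Qed.

End Ellipsoid.

Theorem theorem18 (R : realType) (mu : nat -> R) (mu_gt0 : forall n, 0 < mu n)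
    (eps : R) (eps_gt0 : 0 < eps) :
  metric_entropy eps (ellipsoid_infty mu) =
  (\sum_(1 <= k <oo) ((log2 (1 + k%:R^-1)%R)%:E * counting_fun mu k eps))%E.
Proof.
have /choice[K KP] n := multiples_lt (mu_gt0 n) eps_gt0.
rewrite (counting_sum_log2 KP) /metric_entropy.
set S := (\sum_(n <oo) _)%E.
have term_ge0 n : (0 <= (log2 ((K n).+1%:R : R))%:E)%E.
  by rewrite lee_fin log2_ge0 // ler1n.
have prod_gt0 J : 0 < (\prod_(i < J) (K i).+1)%:R :> R.
  by rewrite ltr0n prodn_gt0.
have logprod J : log2e (\prod_(i < J) (K i).+1)%:R%:E =
    (\sum_(0 <= i < J) (log2 ((K i).+1%:R : R))%:E)%E.
  by rewrite log2e_EFin // log2_prod sumEFin.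
apply/eqP; rewrite eq_le; apply/andP; split; last first.
  (* Each partial sum of [S] is the logarithm of a finite product bounding the covering number from
     below; this also settles the case where [S] is infinite. *)
  apply: lime_le; first exact: is_cvg_nneseries.
  apply: nearW => J; rewrite -logprod; apply: le_log2e.
    by rewrite lee_fin ltW.
  exact: covering_number_ge.
have [->|Sfin] := eqVneq S +oo%E; first exact: leey.
have Slt : (S < +oo)%E by rewrite ltey.
have tail0 := nneseries_tail_cvg Slt (fun n _ => term_ge0 n).
(* The threshold 1 is [log2 2], the least nonzero value of a term: a tail below 1 forces [K n = 0]
   for each of its indices. *)
have [J _ JP] : \forall N \near \oo,
    (\sum_(N <= k <oo) (log2 ((K k).+1%:R : R))%:E < 1%:E)%E.
  apply: (tail0 [set y | (y < 1%:E)%E]).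
  by apply: open_ereal_lt'; rewrite lte01.
have K0 n : (J <= n)%N -> K n = 0%N.
  move=> /JP /= tail1; apply/eqP; rewrite -leqn0 -ltnS.
  have := le_lt_trans (nneseries_lim_ge n.+1 (fun k _ _ => term_ge0 k)) tail1.
  rewrite big_nat1 lte_fin ltr_pdivrMr ?ln_gt0 ?ltr1n // mul1r ltr_ln ?posrE //.
  by rewrite ltr_nat.
apply: le_trans (le_log2e _ (covering_number_le mu_gt0 KP eps_gt0 K0)) _.
  by apply/ereal_infP => _ [C _ <-]; rewrite /counting; case: asboolP.
by rewrite logprod; exact: nneseries_lim_ge.
Qed.
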